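(* Let $\{a,b,c\}=\{1,2,3\}$. For $n\ge 1$, $a_n(a;b\to c)=2^{n-1}$.
   Context: Standard cycle form of $\sigma\in S_n$: $\sigma$ is written as a product of disjoint cycles (fixed points included), each cycle starting with its largest element, cycles listed in increasing order of their largest elements. The fundamental bijection $\theta:S_n\to S_n$ sends $\sigma$ to the permutation whose one-line notation is obtained by erasing the parentheses from the standard cycle form of $\sigma$. For $\pi\in S_n$ write $\hat\pi=\theta^{-1}(\pi)$. An arrow pattern $\alpha=(\nu;H)$ of size $k$ consists of a string $\nu=a_1\dots a_m$ of positive integers and a set $H=\{b_i\to c_i\}$ of arrows such that the integers appearing in $\nu$ or $H$ form exactly $[k]$. $\pi\in S_n$ contains $\alpha$ if there is $X=\{x_1<\dots<x_k\}\subseteq[n]$ such that there are positions $t_1<\dots<t_m$ with $\pi_{t_1}\cdots\pi_{t_m}=x_{a_1}\cdots x_{a_m}$, and $\hat\pi(x_{b_i})=x_{c_i}$ for every arrow $b_i\to c_i\in H$; otherwise $\pi$ avoids $\alpha$. $a_n(\nu;H)$ is the number of $\pi\in S_n$ avoiding $(\nu;H)$. Here $(a;b\to c)$ is the size-3 arrow pattern with one-letter string $\nu=a$ and single arrow $b\to c$. *)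

(* Defs.v *)
From mathcomp Require Import all_boot fingroup perm.

Set Implicit Arguments.
Unset Strict Implicit.
Unset Printing Implicit Defensive.

(* The set [n] is represented by 'I_n throughout, so that letters and values
   1, ..., n become 0, ..., n-1; permutations of [n] have type 'S_n, and the
   one-line notation of p : 'S_n is the word p 0, p 1, ..., p (n-1). *)

Section FundamentalBijection.

Variable n : nat.
Implicit Types (s t : 'S_n) (i j : 'I_n).

Definition cycle_leader s i : bool := all (fun j : 'I_n => j <= i) (orbit s i).

(* [enum 'I_n] is increasing, and [orbit s i] is [:: i; s i; s (s i); ...]. *)
Definition std_cycles s : seq (seq 'I_n) :=
  [seq orbit s i | i <- enum 'I_n & cycle_leader s i].

Definition theta_word s : seq 'I_n := flatten (std_cycles s).

Lemma cycle_leader_eq s i j :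
  cycle_leader s i -> cycle_leader s j -> j \in orbit s i -> i = j.
Proof.
move=> /allP li /allP lj ji; apply/val_inj/anti_leq.
rewrite (li _ ji) andbT; apply: lj.
by rewrite -fconnect_orbit fconnect_sym ?fconnect_orbit //; apply: perm_inj.
Qed.

Lemma mem_theta_word s j : j \in theta_word s.
Proof.
have [i ij maxi] := @arg_maxnP _ j (fun i => i \in orbit s j) val (in_orbit s j).
have cj : fconnect s j i by rewrite fconnect_orbit.
have sym := fconnect_sym (@perm_inj _ s).
apply/flattenP; exists (orbit s i); last by rewrite -fconnect_orbit sym.
apply/mapP; exists i => //; rewrite mem_filter mem_enum andbT.
apply/allP => k; rewrite -fconnect_orbit => ik; apply: maxi.
by rewrite -fconnect_orbit (connect_trans cj ik).
Qed.

Lemma theta_word_uniq s : uniq (theta_word s).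
Proof.
rewrite /theta_word /std_cycles.
have: all (cycle_leader s) [seq i <- enum 'I_n | cycle_leader s i].
  exact: filter_all.
have: uniq [seq i <- enum 'I_n | cycle_leader s i].
  by rewrite filter_uniq ?enum_uniq.
elim: [seq i <- _ | _] => //= i l IHl /andP[il ul] /andP[li ll].
rewrite cat_uniq orbit_uniq IHl // andbT /=.
apply/hasPn => k /flattenP[_ /mapP[j jl ->] kj]; apply/negP => ki.
case/negP: il; suff -> : i = j by [].
apply: (@cycle_leader_eq s) => //; first exact: (allP ll).
move: ki kj; rewrite -!fconnect_orbit => ki kj.
by apply: connect_trans ki _; rewrite fconnect_sym //; apply: perm_inj.
Qed.

Lemma size_theta_word s : size (theta_word s) = n.
Proof.
rewrite -[RHS]card_ord -(card_uniqP (theta_word_uniq s)).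
by apply: eq_card => j; rewrite !inE mem_theta_word.
Qed.

Lemma theta_fun_inj s : injective (fun i => nth i (theta_word s) i).
Proof.
move=> i j /eqP; rewrite (set_nth_default j) ?size_theta_word //.
by rewrite nth_uniq ?size_theta_word ?theta_word_uniq // => /eqP/val_inj.
Qed.

Definition theta s : 'S_n := perm (@theta_fun_inj s).

Definition head_lt (c d : seq 'I_n) : bool :=
  if c is x :: _ then if d is y :: _ then x < y else false else false.

Lemma orbitE s i : orbit s i = i :: traject s (s i) (fingraph.order s i).-1.
Proof. by rewrite /orbit -orderSpred. Qed.

Lemma std_cycles_sorted s : sorted head_lt (std_cycles s).
Proof.
rewrite /std_cycles sorted_map.
apply: (@sub_sorted _ (fun i j : 'I_n => i < j)).
  by move=> i j ij; rewrite /relpre /= !orbitE.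
apply: sorted_filter; first by move=> x y z; apply: ltn_trans.
rewrite -[sorted _ _]/(sorted (relpre val ltn) _) -sorted_map val_enum_ord.
exact: iota_ltn_sorted.
Qed.

Definition led (c : seq 'I_n) : bool :=
  if c is x :: c' then all (fun j : 'I_n => j < x) c' else false.

Lemma std_cycles_led s : all led (std_cycles s).
Proof.
apply/allP => _ /mapP[i + ->]; rewrite mem_filter => /andP[/allP li _].
have := orbit_uniq s i; move: li; rewrite orbitE /=.
move=> li /andP[ni _]; apply/allP => j jl.
rewrite ltn_neqAle li ?inE ?jl ?orbT // andbT.
by apply: contraNneq ni => /val_inj ji; move: jl; rewrite ji.
Qed.

Lemma led_flatten_inj (c d : seq (seq 'I_n)) :
  all led c -> all led d -> sorted head_lt c -> sorted head_lt d ->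
  flatten c = flatten d -> c = d.
Proof.
elim: c d => [|[|x u] c IHc] [|[|y v] d] //=.
move=> /andP[lu lc] /andP[lv ld] pc pd [xy E]; subst y.
have aux (u' v' : seq 'I_n) e f : all led e -> path head_lt (x :: u') e ->
    all (fun j : 'I_n => j < x) v' -> u' ++ flatten e = v' ++ f ->
    size v' <= size u'.
  case: e => [|[|y w] e] //=.
    by rewrite cats0 => _ _ _ ->; rewrite size_cat leq_addr.
  move=> _ /andP[xy _] av Euv; rewrite leqNgt; apply/negP => lt.
  have := congr1 (fun l => nth x l (size u')) Euv => /=.
  rewrite !nth_cat ltnn subnn lt /= => Ey.
  have /(all_nthP x)/(_ _ lt) := av; rewrite -Ey => yx.
  by have := ltn_trans xy yx; rewrite ltnn.
have sz : size u = size v.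
  apply/anti_leq; rewrite (aux u v c (flatten d)) // andbT.
  by rewrite (aux v u d (flatten c)).
move/eqP: E; rewrite eqseq_cat // => /andP[/eqP-> /eqP Ef].
by rewrite (IHc d) // ?(path_sorted pc) ?(path_sorted pd).
Qed.

Lemma theta_inj : injective theta.
Proof.
move=> s t E.
have Ew : theta_word s = theta_word t.
  case: (posnP n) => [n0|n_gt0].
    by apply: (etrans (size0nil _) (esym (size0nil _))); rewrite size_theta_word.
  apply: (@eq_from_nth _ (Ordinal n_gt0)); rewrite !size_theta_word // => k kn.
  have := congr1 (fun p : 'S_n => p (Ordinal kn)) E; rewrite !permE /=.
  by rewrite !(set_nth_default (Ordinal n_gt0) (Ordinal kn)) ?size_theta_word.
have Ec : std_cycles s = std_cycles t.
  by apply: led_flatten_inj Ew; rewrite ?std_cycles_led ?std_cycles_sorted.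
apply/permP => j.
have /flattenP[c cs jc] := mem_theta_word s j.
have nextE p : c \in std_cycles p -> p j = next c j.
  case/mapP=> i _ ci; have pI : injective p by apply: perm_inj.
  by apply/eqP; have := next_cycle (cycle_orbit pI i); rewrite -ci; apply.
by rewrite nextE // [RHS]nextE // -Ec.
Qed.

Definition hat (p : 'S_n) : 'S_n := invF theta_inj p.

Lemma hatK : cancel hat theta. Proof. exact: f_invF. Qed.

End FundamentalBijection.

(* An arrow b -> c is the pair (b, c). *)
Record arrow_pattern (k : nat) := ArrowPattern {
  nu : seq 'I_k;
  arrows : {set 'I_k * 'I_k};
  arrow_patternP : forall i : 'I_k,
    i \in nu \/ exists2 h, h \in arrows & i = h.1 \/ i = h.2
}.

Definition increasing m n (f : {ffun 'I_m -> 'I_n}) : bool :=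
  [forall i : 'I_m, forall j : 'I_m, (i < j) ==> (f i < f j)].

(* The subset X = {x_1 < ... < x_k} is given by its increasing enumeration. *)
Definition contains n k (p : 'S_n) (alpha : arrow_pattern k) : bool :=
  [exists x : {ffun 'I_k -> 'I_n},
    [&& increasing x,
        [exists t : {ffun 'I_(size (nu alpha)) -> 'I_n},
          increasing t &&
          [forall j, p (t j) == x (tnth (in_tuple (nu alpha)) j)]]
      & [forall h in arrows alpha, hat p (x h.1) == x h.2]]].

Definition avoids n k (p : 'S_n) (alpha : arrow_pattern k) : bool :=
  ~~ contains p alpha.

Definition avoid_count n k (alpha : arrow_pattern k) : nat :=
  #|[set p : 'S_n | avoids p alpha]|.

Lemma arrow1_proof (a b c : 'I_3) (habc : [set a; b; c] = [set: 'I_3]) (i : 'I_3) :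
  i \in [:: a] \/ exists2 h, h \in [set (b, c)] & i = h.1 \/ i = h.2.
Proof.
have: i \in [set a; b; c] by rewrite habc inE.
rewrite !inE => /orP[/orP[->|/eqP->]|/eqP->]; [by left | right | right].
- by exists (b, c); [rewrite inE | left].
- by exists (b, c); [rewrite inE | right].
Qed.

(* The pattern (a; b -> c). *)
Definition arrow1 (a b c : 'I_3) (habc : [set a; b; c] = [set: 'I_3]) :
    arrow_pattern 3 :=
  ArrowPattern (arrow1_proof habc).
Arguments arrow1 : clear implicits.

(* Main.v *)
Require Import Defs.
From mathcomp Require Import all_boot fingroup perm.

(** Every value occurs in a one-line word, so the letter [a] only forces the
    three-element set X to exist; as theta is a bijection, one counts the
    permutations s having no x_1 < x_2 < x_3 with s x_b = x_c.  Inversion and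
    conjugation by the reversal reduce to (b, c) = (1, 3) and (2, 3).  The
    former says s i <= i + 1 for all i, the latter s i <= i for all i but the
    smallest, and precomposing with a cyclic shift exchanges the two.  Finally
    the number of s with s i <= i + 1 doubles with n: the largest value sits in
    one of the last two positions, and deleting it gives every smaller such
    permutation. *)

Set Implicit Arguments.
Unset Strict Implicit.
Unset Printing Implicit Defensive.

(** * From pattern avoidance to a condition on one arrow *)

Lemma increasingP m n (f : {ffun 'I_m -> 'I_n}) :
  reflect (forall i j : 'I_m, i < j -> f i < f j) (increasing f).
Proof.
apply: (iffP forallP) => [H i j|H i]; first exact/implyP/(forallP (H i)).
by apply/forallP => j; apply/implyP/H.
Qed.

Definition arrow_in n (b c : 'I_3) (s : 'S_n) : bool :=
  [exists x : {ffun 'I_3 -> 'I_n}, increasing x && (s (x b) == x c)].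

Definition arrow_avoiders n (b c : 'I_3) : {set 'S_n} :=
  [set s | ~~ arrow_in b c s].

Lemma contains_arrow1 n (p : 'S_n) a b c habc :
  contains p (arrow1 a b c habc) = arrow_in b c (hat p).
Proof.
apply/existsP/existsP => -[x].
  case/and3P=> ix _ /forall_inP/(_ (b, c)).
  by rewrite inE eqxx => /(_ isT) /= sx; exists x; rewrite ix.
case/andP=> ix sx; exists x; apply/and3P; split=> //.
  apply/existsP; exists [ffun => (p^-1)%g (x a)]; apply/andP; split.
    by apply/increasingP => -[[|i] hi] [[|j] hj].
  by apply/forallP => j; rewrite ffunE permKV (ord1 j) (tnth_nth a).
by apply/forall_inP => h; rewrite inE => /eqP->.
Qed.

Lemma hat_inj n : injective (@hat n).
Proof. exact: can_inj (@hatK n). Qed.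

Lemma avoid_count_arrow1 n a b c habc :
  avoid_count n (arrow1 a b c habc) = #|arrow_avoiders n b c|.
Proof.
rewrite -(card_preimset _ (@hat_inj n)); apply: eq_card => p.
by rewrite !inE /avoids contains_arrow1.
Qed.

(** * Symmetries of the arrow *)

Lemma card_arrow_avoiders_inv n b c :
  #|arrow_avoiders n b c| = #|arrow_avoiders n c b|.
Proof.
rewrite -(card_preimset _ (@invg_inj 'S_n)); apply: eq_card => s.
rewrite !inE; congr negb; apply: eq_existsb => x; congr andb.
by rewrite -(inj_eq (@perm_inj _ s)) permKV eq_sym.
Qed.

Lemma ltn_rev_ord n (i j : 'I_n) : (rev_ord i < rev_ord j) = (j < i).
Proof. by rewrite /= ltn_sub2lE // ltnS. Qed.

(** Conjugating by the reversal [r] carries an occurrence on X to one on the reversed X. One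
    implication suffices, since [r] is an involution. *)
Lemma card_arrow_avoiders_rev n b c :
  #|arrow_avoiders n b c| = #|arrow_avoiders n (rev_ord b) (rev_ord c)|.
Proof.
pose r := perm (@rev_ord_inj n).
have rE i : r i = rev_ord i by rewrite permE.
pose rx (x : {ffun 'I_3 -> 'I_n}) := [ffun i => rev_ord (x (rev_ord i))].
have rxI x : increasing x -> increasing (rx x).
  move=> /increasingP ix; apply/increasingP => i j ij; rewrite !ffunE.
  by rewrite ltn_rev_ord ix // ltn_rev_ord.
have imp b' c' s : arrow_in b' c' s ->
    arrow_in (rev_ord b') (rev_ord c') (s ^ r)%g.
  case/existsP=> x /andP[ix /eqP sx]; apply/existsP; exists (rx x).
  by rewrite rxI // !ffunE !rev_ordK -!rE permJ sx eqxx.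
have rr : (r * r = 1)%g by apply/permP => i; rewrite permM !rE rev_ordK perm1.
rewrite -[RHS](card_preimset _ (@conjg_inj _ r)); apply: eq_card => s.
rewrite !inE; congr negb; apply/idP/idP; first exact: imp.
by move/imp; rewrite !rev_ordK -conjgM rr conjg1.
Qed.

(** * Counting by insertion of the largest value *)

Definition staircase n : {set 'S_n} := [set s : 'S_n | [forall i, s i <= i.+1]].

Lemma staircaseP n (s : 'S_n) :
  reflect (forall i, s i <= i.+1) (s \in staircase n).
Proof. by rewrite inE; apply: forallP. Qed.

Lemma lift_perm_inj n (i j : 'I_n.+1) : injective (lift_perm i j).
Proof.
move=> s t E; apply/permP => k; apply: (@lift_inj _ j).
by rewrite -!(lift_perm_lift i) E.
Qed.

Lemma lift_perm_surj n (i : 'I_n.+1) (s : 'S_n.+1) :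
  exists t, s = lift_perm i (s i) t.
Proof.
have ne k : s i != s (lift i k) by rewrite (inj_eq perm_inj) neq_lift.
(* Delete position [i] and value [s i]; by [ne] the default [k] is never taken. *)
pose f k := odflt k (unlift (s i) (s (lift i k))).
have fE k : lift (s i) (f k) = s (lift i k).
  by rewrite /f; have [l -> /= ->] := unlift_some (ne k).
have fI : injective f.
  by move=> k l E; apply/(@lift_inj _ i)/(@perm_inj _ s); rewrite -!fE E.
exists (perm fI); apply/permP => k; have [l ->|->] := unliftP i k.
  by rewrite lift_perm_lift permE fE.
by rewrite lift_perm_id.
Qed.

(** Insertion never moves an entry to the left, so no bound gets stricter. Conversely, the only
    entry that can move is the last one of [t], whose bound is vacuous. *)
Lemma lift_perm_staircase n (i : 'I_n.+2) (t : 'S_n.+1) :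
  n <= i -> (lift_perm i ord_max t \in staircase n.+2) = (t \in staircase n.+1).
Proof.
move=> ni; apply/staircaseP/staircaseP => H k.
  have [->|kn] := eqVneq k ord_max; first exact: ltnW.
  have kltn : k < n by rewrite ltn_neqAle kn -ltnS ltn_ord.
  have := H (lift i k); rewrite lift_perm_lift lift_max /= /bump.
  by rewrite [i <= k]leqNgt (leq_trans kltn ni).
have [l ->|->] := unliftP i k; last by rewrite lift_perm_id.
rewrite lift_perm_lift lift_max (leq_trans (H l)) //= ltnS.
exact: leq_addl.
Qed.

Lemma card_staircase n : #|staircase n.+1| = 2 ^ n.
Proof.
elim: n => [|n IHn].
  rewrite (_ : staircase 1 = setT) ?cardsT ?card_Sn //.
  by apply/setP => s; rewrite in_setT; apply/staircaseP => i; rewrite !ord1.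
pose ins (i : 'I_n.+2) := [set lift_perm i ord_max t | t in staircase n.+1].
pose m : 'I_n.+2 := inord n.
have mE : m = n :> nat by rewrite inordK.
have insE i s : s \in ins i -> s i = ord_max.
  by case/imsetP=> t _ ->; rewrite lift_perm_id.
rewrite (_ : staircase _ = ins m :|: ins ord_max).
  rewrite cardsU disjoint_setI0 ?cards0 ?subn0.
    rewrite !card_imset; try exact: lift_perm_inj.
    by rewrite IHn addnn -mul2n -expnS.
  apply/pred0P => s /=; apply/negP => /andP[/insE sm /insE sM].
  have /(congr1 val)/= := perm_inj (etrans sm (esym sM)).
  by rewrite mE => /n_Sn.
apply/setP => s; rewrite in_setU; apply/idP/orP.
  move=> ss; pose i := (s^-1)%g ord_max.
  have si : s i = ord_max by rewrite permKV.
  (* The bound at [i] reads n + 1 <= i + 1. *)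
  have ni : n <= i by have /staircaseP/(_ i) := ss; rewrite si.
  have [t st] := lift_perm_surj i s; rewrite si in st.
  have si' : s \in ins i.
    by rewrite st; apply: imset_f; rewrite -(lift_perm_staircase _ ni) -st.
  have := ni; rewrite leq_eqVlt => /orP[/eqP E|lt].
    by left; rewrite (_ : m = i) //; apply: val_inj; rewrite /= mE.
  right; rewrite (_ : ord_max = i) //; apply/val_inj/anti_leq.
  by rewrite lt -ltnS ltn_ord.
by case=> /imsetP[t ts ->]; rewrite lift_perm_staircase ?mE.
Qed.

(** * The arrows 1 -> 3 and 2 -> 3 *)

Definition triple n (u v w : 'I_n) : {ffun 'I_3 -> 'I_n} :=
  [ffun i : 'I_3 => nth u [:: u; v; w] i].

Lemma increasing_triple n (u v w : 'I_n) :
  u < v -> v < w -> increasing (triple u v w).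
Proof.
move=> uv vw; apply/increasingP => -[[|[|[|//]]] ?] [[|[|[|//]]] ?] //= _;
  by rewrite !ffunE //= (ltn_trans uv).
Qed.

Lemma arrow_inP n b c (s : 'S_n) :
  reflect (exists u v w : 'I_n,
             [/\ u < v, v < w & s (triple u v w b) = triple u v w c])
          (arrow_in b c s).
Proof.
apply: (iffP existsP) => [[x /andP[/increasingP ix /eqP sx]]|].
  exists (x ord0), (x (inord 1)), (x ord_max).
  split; try by apply: ix; rewrite inordK.
  rewrite (_ : triple _ _ _ = x) //; apply/ffunP => -[[|[|[|//]]] i3];
    by rewrite ffunE /=; congr (x _); apply: val_inj; rewrite //= inordK.
case=> u [v [w [uv vw suvw]]]; exists (triple u v w).
by rewrite increasing_triple // suvw eqxx.
Qed.

(** A middle element fits between [i] and [s i] exactly when [s i] exceeds i + 1, and then i + 1 is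
    one. *)
Lemma arrow_avoiders13 n : arrow_avoiders n ord0 ord_max = staircase n.
Proof.
apply/setP => s; rewrite inE; apply/idP/staircaseP => [H i|H].
  rewrite leqNgt; apply: contra H => lt.
  have ltn : i.+1 < n := ltn_trans lt (ltn_ord _).
  by apply/arrow_inP; exists i, (Ordinal ltn), (s i); rewrite !ffunE.
apply/negP => /arrow_inP[u [v [w [uv vw]]]]; rewrite !ffunE /= => su.
by have := H u; rewrite su leqNgt (leq_ltn_trans uv vw).
Qed.

Lemma card_arrow_avoiders13 n : #|arrow_avoiders n.+1 ord0 ord_max| = 2 ^ n.
Proof. by rewrite arrow_avoiders13 card_staircase. Qed.

Lemma card_arrow_avoiders23 n :
  #|arrow_avoiders n.+1 (inord 1) ord_max| = 2 ^ n.
Proof.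
rewrite -card_staircase.
(* The staircase bound for [(r * s)%g] at [i] is s (i + 1) <= i + 1; at the last [i] the shift wraps
   to 0 and the bound is vacuous. *)
pose r := perm (@ordS_inj n.+1).
rewrite -[RHS](card_preimset _ (mulgI r)); apply: eq_card => s.
rewrite [in RHS]inE inE; apply/idP/staircaseP => [H i|H].
  rewrite permM permE leqNgt; apply: contra H => lt.
  (* No wrap-around here, so [ordS i] is i + 1, which is positive and leaves [ord0] as smallest
     element. *)
  have iS : i.+1 < n.+1 := ltn_trans lt (ltn_ord _).
  apply/arrow_inP; exists ord0, (ordS i), (s (ordS i)).
  by rewrite !ffunE /= inordK //= modn_small.
apply/negP => /arrow_inP[u [v [w [uv vw]]]]; rewrite !ffunE /= inordK //= => sv.
(* As u < v, [v] is nonzero and its cyclic predecessor is v - 1. *)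
have := H (ord_pred v); rewrite permM permE ord_predK sv /=.
case: v uv vw {sv} => -[//|v] /= vn _ vw.
by rewrite modnDr modn_small ?(ltnW vn) // leqNgt vw.
Qed.

Lemma card_arrow_avoiders n b c : b != c -> #|arrow_avoiders n.+1 b c| = 2 ^ n.
Proof.
wlog bc : b c / b < c => [IH|_].
  move=> bc; have := bc; rewrite -val_eqE neq_ltn => /orP[lt|lt].
    exact: IH.
  by rewrite card_arrow_avoiders_inv IH // eq_sym.
have I3 (i j : 'I_3) : i = j :> nat -> i = j by apply: val_inj.
case: b c bc => [[|[|[|//]]] b3] [[|[|[|//]]] c3] // _.
(* Inversion turns 1 -> 2 into 2 -> 1, and reversal turns that into 2 -> 3. *)
- rewrite card_arrow_avoiders_inv card_arrow_avoiders_rev.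
  by rewrite -(card_arrow_avoiders23 n); congr #|arrow_avoiders _ _ _|;
    apply: I3; rewrite //= inordK.
- by rewrite -(card_arrow_avoiders13 n); congr #|arrow_avoiders _ _ _|;
    apply: I3.
- by rewrite -(card_arrow_avoiders23 n); congr #|arrow_avoiders _ _ _|;
    apply: I3; rewrite //= inordK.
Qed.

Theorem theorem2p4 (a b c : 'I_3) (habc : [set a; b; c] = [set: 'I_3])
  (n : nat) (hn : 1 <= n) :
  avoid_count n (arrow1 a b c habc) = 2 ^ (n - 1).
Proof.
rewrite avoid_count_arrow1; case: n hn => // n _.
(* If b = c, then {a, b, c} has at most two elements, not three. *)
rewrite subn1 card_arrow_avoiders //; apply/eqP => bc; subst c.
have := congr1 (fun A : {set 'I_3} => #|A|) habc.
rewrite cardsT card_ord -setUA setUid => E.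
by have [+ _] := leq_card_setU [set a] [set b]; rewrite E !cards1.
Qed.
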